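(* If $\mathcal{A}$ is a von Neumann algebra acting on a complex Hilbert space $\mathcal{H}$, then the right-invariant order on $\mathrm{PPU}(\mathcal{A})$ defined by the positive cone $\mathrm{PPU}^+(\mathcal{A})$ makes $\mathrm{PPU}(\mathcal{A})$ a lattice.
   Context: $\mathcal{A}[t,t^{-1}]$ is the ring of finite Laurent polynomials $\varphi=\sum_i t^i\varphi_i$, $\varphi_i\in\mathcal{A}$ (with $t$ central), with involution $\varphi^{\ast}=\sum_i t^{-i}\varphi_i^{\ast}$, where $\varphi_i^{\ast}$ is the adjoint. $\mathcal{A}[t]$ is the subset of those $\varphi$ with $\varphi_i=0$ for $i<0$. The pure paraunitary group is $\mathrm{PPU}(\mathcal{A})=\{\varphi\in\mathcal{A}[t,t^{-1}]:\varphi^{\ast}\varphi=\varphi\varphi^{\ast}=1,\ \sum_i\varphi_i=1\}$ under multiplication, and $\mathrm{PPU}^+(\mathcal{A})=\mathrm{PPU}(\mathcal{A})\cap\mathcal{A}[t]$. The right-invariant order defined by this positive cone is: $\varphi\le\varphi'$ if and only if $\varphi'\varphi^{-1}\in\mathrm{PPU}^+(\mathcal{A})$. *)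

(* Defs.v *)
From HB Require Import structures.
From mathcomp Require Import all_boot all_order all_algebra ring lra.
From mathcomp Require Import finmap complex sesquilinear.
From mathcomp Require Import all_classical all_reals all_analysis.

Set Implicit Arguments.
Unset Strict Implicit.
Unset Printing Implicit Defensive.

Import Order.TTheory GRing.Theory Num.Theory numFieldNormedType.Exports.
Local Open Scope classical_set_scope.
Local Open Scope ring_scope.
Local Open Scope complex_scope.

(* Complex Hilbert spaces over the reals R: a Banach space over R[i] whose norm
   comes from an inner product, linear in its first argument. *)
HB.mixin Record isHilbert (R : realType) H of CompleteNormedModule R[i] H := {
  dotH : {dot H for Num.conj};
  dot_normE : forall x : H, dotH x x = `|x| ^+ 2
}.

#[short(type="hilbertType")]
HB.structure Definition Hilbert (R : realType) :=
  {H of isHilbert R H & CompleteNormedModule R[i] H}.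

Section HilbertTheory.
Variables (R : realType) (H : hilbertType R).
Implicit Types x y v : H.

Lemma dotC x y : dotH y x = (dotH x y)^*%R.
Proof. by rewrite hermC /= expr0 mul1r. Qed.

Lemma dotDl x y v : dotH (x + y) v = dotH x v + dotH y v.
Proof. exact: linearDl. Qed.

Lemma dotDr x y v : dotH v (x + y) = dotH v x + dotH v y.
Proof. exact: linearD. Qed.

Lemma dotZl (a : R[i]) x v : dotH (a *: x) v = a * dotH x v.
Proof. exact: linearZl_LR. Qed.

Lemma dotZr (a : R[i]) x v : dotH v (a *: x) = a^*%R * dotH v x.
Proof. exact: linearZ. Qed.

Lemma dotNl x v : dotH (- x) v = - dotH x v.
Proof. exact: linearNl. Qed.

Lemma dotNr x v : dotH v (- x) = - dotH v x.
Proof. exact: linearN. Qed.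

Lemma dotBl x y v : dotH (x - y) v = dotH x v - dotH y v.
Proof. by rewrite dotDl dotNl. Qed.

Lemma dotBr x y v : dotH v (x - y) = dotH v x - dotH v y.
Proof. by rewrite dotDr dotNr. Qed.

Lemma riesz_aux (F : realDomainType) (n r M : F) : r <= M * n ->
  - M ^+ 2 <= n ^+ 2 - 2 * r.
Proof. move=> h; have := sqr_ge0 (n - M); nra. Qed.

Lemma dot_cauchy_schwarz x y : `|dotH x y| <= `|x| * `|y|.
Proof.
have [->|y0] := eqVneq y 0.
  by rewrite -(scale0r (0 : H)) dotZr rmorph0 mul0r normr0 mulr_ge0.
have q0 : 0 < `|y| ^+ 2 by rewrite exprn_gt0 ?normr_gt0.
rewrite -(ler_pXn2r (_ : 0 < 2)%N) ?nnegrE ?mulr_ge0 // exprMn.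
rewrite -ler_pdivrMr // -subr_ge0.
have : 0 <= dotH (x - (dotH x y / `|y| ^+ 2) *: y)
                 (x - (dotH x y / `|y| ^+ 2) *: y).
  by rewrite dot_normE exprn_ge0.
congr (_ <= _); rewrite dotBl !dotBr !dotZr !dotZl (dotC x y) normCK.
have /lt0r_neq0 := q0; rewrite -!dot_normE.
have qr : (dotH y y)^*%R = dotH y y by rewrite -dotC.
rewrite !(rmorphM, fmorphV) /= qr.
move: (dotH x y) (dotH x y)^*%R (dotH y y) (dotH x x) => *.
by field.
Qed.

Section Riesz.
Variables (l : H -> R[i]) (M : R).
Hypothesis lD : forall x y, l (x + y) = l x + l y.
Hypothesis lZ : forall (a : R[i]) x, l (a *: x) = a * l x.
Hypothesis lM : forall x, `|l x| <= M%:C * `|x|.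

Let Jc x := dotH x x - l x - (l x)^*%R.
Let J x := complex.Re (Jc x).

Let JE x : (J x)%:C = Jc x.
Proof.
rewrite /J RRe_real // /Jc -addrA -opprD dot_normE rpredB //.
  by rewrite rpredX // normr_real.
by apply/CrealP; rewrite rmorphD /= conjCK addrC.
Qed.

Let Jmin x v : v != 0 ->
  exists y, Jc y = Jc x - `|l v - dotH v x| ^+ 2 / `|v| ^+ 2.
Proof.
move=> v0; have [d dE] : exists d : R[i], l v - dotH v x = d by eexists.
rewrite dE.
have q0 : dotH v v != 0 by rewrite dot_normE expf_neq0 // normr_eq0.
have qr : (dotH v v)^*%R = dotH v v by rewrite -dotC.
exists (x + (d^*%R / dotH v v) *: v).
rewrite -dot_normE normCK /Jc.
rewrite lD lZ dotDl !dotDr !dotZr !dotZl (dotC v x).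
rewrite !(rmorphD, rmorphM, fmorphV, conjCK) /= !conjCK qr.
have -> : (dotH v x)^*%R = (l v)^*%R - d^*%R by rewrite -dE rmorphB /= subKr.
have -> : dotH v x = l v - d by rewrite -dE subKr.
clear dE; move: (l v) (l v)^*%R d (d^*%R) (dotH v v) (l x) (l x)^*%R (dotH x x) q0 => *.
by field.
Qed.

Let Jlb x : - M ^+ 2 <= J x.
Proof.
have := lM x; move: (normr_real x) => /RRe_real <-.
set n := complex.Re _.
rewrite -rmorphM /= => h.
have Jx : (J x)%:C = `|x| ^+ 2 - (2 * complex.Re (l x))%:C.
  by rewrite JE /Jc dot_normE -addrA -opprD; congr (_ - _);
     rewrite rmorphM rmorph_nat /= -[RHS]addcJ.
have hn : `|x| = n%:C by rewrite /n RRe_real // normr_real.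
have hr : complex.Re (l x) <= M * n.
  rewrite -lecR; apply: le_trans h; apply: le_trans (normc_ge_Re _).
  by rewrite lecR ler_norm.
move: Jx; rewrite hn -rmorphXn -rmorphB /= => -[->].
exact: riesz_aux.
Qed.

Lemma riesz_approx e : 0 < e ->
  exists x, forall v, `|l v - dotH v x| <= `|v| * e%:C.
Proof.
move=> e0.
have hE : has_inf (range J).
  split; first by exists (J 0), 0.
  by exists (- M ^+ 2) => _ [x _ <-].
have [_ [x _ <-] hx] := inf_adherent (exprn_gt0 2 e0) hE.
exists x => v; have [->|v0] := eqVneq v 0.
  have l0 : l 0 = 0 by rewrite -(scale0r (0 : H)) lZ mul0r.
  by rewrite l0 normr0 mul0r -(scale0r (0 : H)) dotZl mul0r subrr normr0.
have [y hy] := Jmin x v0.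
have hxy : J x < J y + e ^+ 2.
  by apply: lt_le_trans hx _; rewrite lerD2r; apply: ge_inf hE.2 _ _; exists y.
have v2 : 0 < `|v| by rewrite normr_gt0.
rewrite -(ler_pXn2r (_ : 0 < 2)%N) ?nnegrE ?mulr_ge0 // ?lecR ?ltW //.
rewrite exprMn [ltRHS]mulrC -ltr_pdivrMr ?exprn_gt0 //.
move: hy; rewrite -!JE => /eqP; rewrite eq_sym subr_eq => /eqP h.
rewrite -(ltrD2l (J y)%:C).
by rewrite -h -rmorphXn -rmorphD ltcR.
Qed.

Lemma riesz : exists x, forall v, l v = dotH v x.
Proof.
pose e n : R := n.+1%:R^-1.
have e0 n : 0 < e n by rewrite invr_gt0.
have /choice[u uP] : forall n, exists x, forall v,
  `|l v - dotH v x| <= `|v| * (e n)%:C by move=> n; exact: riesz_approx.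
have uC m n : `|u m - u n| <= (e m + e n)%:C.
  set w := u m - u n.
  have [->|w0] := eqVneq w 0; first by rewrite normr0 lecR addr_ge0 // ltW.
  rewrite -(ler_pM2l (_ : 0 < `|w|)) ?normr_gt0 // -expr2 -dot_normE.
  rewrite {2}/w dotBr -[leLHS]ger0_norm; last first.
    by rewrite -dotBr -/w dot_normE exprn_ge0.
  have -> : dotH w (u m) - dotH w (u n)
    = (l w - dotH w (u n)) - (l w - dotH w (u m)).
    by rewrite opprB [RHS]addrC addrA subrK.
  apply: (le_trans (ler_normB _ _)).
  by rewrite addrC rmorphD mulrDr lerD.
have small (r : R[i]) : 0 < r -> \forall n \near \oo, (e n)%:C < r.
  move=> r0; have r1 : 0 < complex.Re r by rewrite -ltcR RRe_real // gtr0_real.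
  near=> n; rewrite -(RRe_real (gtr0_real r0)) ltcR.
  by near: n; exact: (near_infty_natSinv_lt (PosNum r1)).
have /cauchy_cvg uc : cauchy (u @ \oo).
  apply/cauchyP => r r0.
  have r20 : 0 < r / 2 by rewrite divr_gt0.
  have [N _ NP] := small _ r20.
  exists (u N); exists N => // n /= Nn.
  rewrite -ball_normE /=; apply: (le_lt_trans (uC _ _)).
  by rewrite rmorphD [r]splitr ltrD // NP //=.
exists (lim (u @ \oo)) => v; set x := lim _.
have [->|v0] := eqVneq v 0.
  by rewrite -(scale0r (0 : H)) lZ dotZl !mul0r.
apply/eqP; rewrite -subr_eq0 -normr_eq0; apply: contraT => d0.
set d := `|_| in d0 *.
have dp : 0 < d by rewrite lt_def d0 normr_ge0.
have vp : 0 < `|v| by rewrite normr_gt0.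
pose r := d / (2 * `|v|).
have r0 : 0 < r by rewrite divr_gt0 // mulr_gt0.
have : \forall n \near \oo, `|x - u n| < r by move/cvgrPdist_lt: uc; exact.
move=> [N _ NP]; have [N' _ NP'] := small _ r0.
pose n := maxn N N'.
have h1 := NP n (leq_maxl _ _); have h2 := NP' n (leq_maxr _ _).
suff : d < d by rewrite ltxx.
rewrite {1}/d.
have -> : l v - dotH v x = (l v - dotH v (u n)) - dotH v (x - u n).
  by rewrite dotBr opprB addrA subrK.
apply: (le_lt_trans (ler_normB _ _)).
apply: (le_lt_trans (lerD (uP n v) (dot_cauchy_schwarz _ _))).
have -> : d = `|v| * r + `|v| * r.
  by rewrite -mulrDr /r; field; rewrite gt_eqF.
by rewrite ltrD // ltr_pM2l.
Unshelve. all: by end_near.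
Qed.
End Riesz.
End HilbertTheory.

Section BoundedOperators.
Variables (R : realType) (H : hilbertType R).

Record bop := Bop {
  bop_fun :> H -> H;
  bop_linear : linear bop_fun;
  bop_continuous : continuous bop_fun }.

HB.instance Definition _ := gen_eqMixin bop.
HB.instance Definition _ := gen_choiceMixin bop.
HB.instance Definition _ (a : bop) :=
  GRing.isLinear.Build R[i] H H *:%R (bop_fun a) (bop_linear a).

Lemma bopP (a b : bop) : a = b <-> forall x, a x = b x.
Proof.
split=> [->//|]; case: a b => [f lf cf] [g lg cg] /= /funext fg.
by subst g; congr Bop; exact: Prop_irrelevance.
Qed.

Lemma bop_bounded (a : bop) :
  exists2 M : R, 0 <= M & forall x, `|a x| <= M%:C * `|x|.
Proof.
have /linear_bounded_continuous/linear_boundedP [r [rr rP]] :=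
  @bop_continuous a.
exists (`|complex.Re r| + 1) => [|x]; first by rewrite addr_ge0.
apply: rP; rewrite -(RRe_real rr) ltcR.
by rewrite (le_lt_trans (ler_norm _)) // ltrDl.
Qed.

Program Definition bop0 := @Bop (fun=> 0) _ _.
Next Obligation. by move=> k x y; rewrite scaler0 addr0. Qed.
Next Obligation. by move=> x; exact: cvg_cst. Qed.

Program Definition bop1 := @Bop id _ _.
Next Obligation. by []. Qed.
Next Obligation. by move=> x. Qed.

Program Definition bop_opp (a : bop) := @Bop (fun x => - a x) _ _.
Next Obligation. by move=> a k x y; rewrite linearP opprD scalerN. Qed.
Next Obligation. by move=> a x; apply: cvgN; exact: bop_continuous. Qed.

Program Definition bop_add (a b : bop) := @Bop (fun x => a x + b x) _ _.
Next Obligation.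
by move=> a b k x y; rewrite !linearP scalerDr addrACA.
Qed.
Next Obligation. by move=> a b x; apply: cvgD; exact: bop_continuous. Qed.

Program Definition bop_mul (a b : bop) := @Bop (fun x => a (b x)) _ _.
Next Obligation. by move=> a b k x y; rewrite !linearP. Qed.
Next Obligation.
by move=> a b x; apply: continuous_comp; exact: bop_continuous.
Qed.

Let addA : associative bop_add.
Proof. by move=> a b c; apply/bopP => x /=; rewrite addrA. Qed.
Let addC : commutative bop_add.
Proof. by move=> a b; apply/bopP => x /=; rewrite addrC. Qed.
Let add0 : left_id bop0 bop_add.
Proof. by move=> a; apply/bopP => x /=; rewrite add0r. Qed.
Let addN : left_inverse bop0 bop_opp bop_add.
Proof. by move=> a; apply/bopP => x /=; rewrite addNr. Qed.
HB.instance Definition _ := GRing.isZmodule.Build bop addA addC add0 addN.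

Let mulA : associative bop_mul.
Proof. by move=> a b c; apply/bopP. Qed.
Let mul1 : left_id bop1 bop_mul.
Proof. by move=> a; apply/bopP. Qed.
Let mul1b : right_id bop1 bop_mul.
Proof. by move=> a; apply/bopP. Qed.
Let mulDl : left_distributive bop_mul bop_add.
Proof. by move=> a b c; apply/bopP. Qed.
Let mulDr : right_distributive bop_mul bop_add.
Proof. by move=> a b c; apply/bopP => x /=; rewrite linearD. Qed.
HB.instance Definition _ :=
  GRing.Zmodule_isPzRing.Build bop mulA mul1 mul1b mulDl mulDr.

Lemma bop0E x : (0 : bop) x = 0. Proof. by []. Qed.
Lemma bopDE (a b : bop) x : (a + b) x = a x + b x. Proof. by []. Qed.
Lemma bopNE (a : bop) x : (- a) x = - a x. Proof. by []. Qed.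
Lemma bopME (a b : bop) x : (a * b) x = a (b x). Proof. by []. Qed.
Lemma bop1E x : (1 : bop) x = x. Proof. by []. Qed.

Lemma dot_injr (x y : H) : (forall v, dotH v x = dotH v y) -> x = y.
Proof.
move=> h; apply/eqP; rewrite -subr_eq0 -normr_eq0 -sqrf_eq0.
by rewrite -dot_normE dotBr h subrr.
Qed.

Definition is_adjoint (a b : bop) := forall x y, dotH (a x) y = dotH x (b y).

Lemma adjoint_unique a b c : is_adjoint a b -> is_adjoint a c -> b = c.
Proof.
by move=> ab ac; apply/bopP => y; apply: dot_injr => x; rewrite -ab -ac.
Qed.

Lemma adjoint_exists a : exists b, is_adjoint a b.
Proof.
have [M M0 aM] := bop_bounded a.
have /choice[f fP] : forall y, exists z, forall x, dotH (a x) y = dotH x z.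
  move=> y; have := normr_real y => /RRe_real yE.
  apply: (@riesz _ _ (fun x => dotH (a x) y) (M * complex.Re `|y|)).
  - by move=> x x'; rewrite linearD dotDl.
  - by move=> k x; rewrite linearZ dotZl.
  - move=> x; apply: (le_trans (dot_cauchy_schwarz _ _)).
    by rewrite rmorphM /= yE mulrAC ler_wpM2r.
have lf : linear f.
  move=> k x y; apply: dot_injr => v.
  by rewrite -fP !dotDr !dotZr -!fP.
pose lfi := GRing.isLinear.Build R[i] H H *:%R f lf.
pose F : {linear H -> H} := HB.pack f lfi.
have cf : continuous f.
  apply/(@linear_bounded_continuous _ _ _ F)/linear_boundedP.
  exists M%:C; split; first by rewrite ger0_real // lecR.
  move=> r Mr x; rewrite /F /=.
  have [->|fx0] := eqVneq (f x) 0.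
    by rewrite normr0 mulr_ge0 // (le_trans _ (ltW Mr)) // lecR.
  rewrite -(ler_pM2l (_ : 0 < `|f x|)) ?normr_gt0 // -expr2 -dot_normE -fP.
  rewrite -[leLHS]ger0_norm; last by rewrite fP dot_normE exprn_ge0.
  apply: (le_trans (dot_cauchy_schwarz _ _)); rewrite mulrA ler_wpM2r //.
  apply: (le_trans (aM _)); rewrite mulrC ler_wpM2l //; exact: ltW.
by exists (Bop lf cf) => x y; exact: fP.
Qed.

Definition adj (a : bop) : bop := projT1 (cid (adjoint_exists a)).

Lemma adjP (a : bop) (x y : H) : dotH (a x) y = dotH x (adj a y).
Proof. exact: (projT2 (cid (adjoint_exists a))). Qed.

Lemma adj_def (a b : bop) : is_adjoint a b -> adj a = b.
Proof. by apply: adjoint_unique => x y; exact: adjP. Qed.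

Lemma adjK : involutive adj.
Proof. by move=> a; apply: adj_def => x y; rewrite dotC -adjP -dotC. Qed.

Lemma adj0 : adj 0 = 0.
Proof.
by apply: adj_def => x y; rewrite !bop0E -(scale0r (0 : H)) dotZl dotZr
  rmorph0 !mul0r.
Qed.

Lemma adj1 : adj 1 = 1. Proof. exact: adj_def. Qed.

Lemma adjD a b : adj (a + b) = adj a + adj b.
Proof. by apply: adj_def => x y; rewrite !bopDE dotDl dotDr !adjP. Qed.

Lemma adjM a b : adj (a * b) = adj b * adj a.
Proof. by apply: adj_def => x y; rewrite !bopME !adjP. Qed.

Definition commutant (A : set bop) : set bop :=
  [set b | forall a, A a -> a * b = b * a].

(* Dixmier's definition of a von Neumann algebra acting on H. Being equal to its
   bicommutant, vna_set is automatically a unital complex subalgebra; by the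
   double commutant theorem this is the same as being a unital *-subalgebra
   that is closed in the weak operator topology. *)
Record von_neumann_algebra := VonNeumannAlgebra {
  vna_set : set bop;
  vna_adj : forall a, vna_set a -> vna_set (adj a);
  vna_bicommutant : commutant (commutant vna_set) = vna_set }.

Section VonNeumannTheory.
Variable A : von_neumann_algebra.

Lemma vnaP a :
  vna_set A a <-> forall b, commutant (vna_set A) b -> b * a = a * b.
Proof. by rewrite -[in vna_set A a]vna_bicommutant. Qed.

Lemma vna0 : vna_set A 0.
Proof. by apply/vnaP => b _; rewrite mulr0 mul0r. Qed.

Lemma vna1 : vna_set A 1.
Proof. by apply/vnaP => b _; rewrite mulr1 mul1r. Qed.

Lemma vnaD a b : vna_set A a -> vna_set A b -> vna_set A (a + b).
Proof.
move=> /vnaP ha /vnaP hb; apply/vnaP => c cA.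
by rewrite mulrDr mulrDl ha // hb.
Qed.

Lemma vnaM a b : vna_set A a -> vna_set A b -> vna_set A (a * b).
Proof.
move=> /vnaP ha /vnaP hb; apply/vnaP => c cA.
by rewrite mulrA ha // -mulrA hb // mulrA.
Qed.
End VonNeumannTheory.
End BoundedOperators.

Section Laurent.
Variable S : pzRingType.

(* Laurent polynomials in a central indeterminate: p i is the coefficient of
   t^i. *)
Record laurent := Laurent {
  lcoef :> int -> S;
  lcoef_finite : finite_set [set i | lcoef i <> 0] }.

HB.instance Definition _ := gen_eqMixin laurent.
HB.instance Definition _ := gen_choiceMixin laurent.
Implicit Types p q r : laurent.

Lemma laurentP p q : p = q <-> forall i, p i = q i.
Proof.
split=> [->//|]; case: p q => [f hf] [g hg] /= /funext fg.
by subst g; congr Laurent; exact: Prop_irrelevance.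
Qed.

Let supp p : {fset int} := fset_set [set i | p i <> 0].

Let supp0 p i : i \notin supp p -> p i = 0.
Proof.
rewrite /supp in_fset_set; last exact: lcoef_finite.
by rewrite notin_setE /= => /contrapT.
Qed.

Let fin (B : {fset int}) (f : int -> S) :
  (forall i, i \notin B -> f i = 0) -> finite_set [set i | f i <> 0].
Proof.
move=> h; apply: sub_finite_set (finite_fset B) => i /= fi.
by apply: contrapT => /negP/h.
Qed.

Let conv_supp p q : {fset int} :=
  [fset (i + j)%R | i in supp p, j in supp q]%fset.

Let conv_supp0 p q k i : k \notin conv_supp p q -> i \in supp p -> q (k - i) = 0.
Proof.
move=> h hi; apply: supp0; apply: contra h => hj.
by apply/imfset2P; exists i => //; exists (k - i) => //; rewrite subrKC.
Qed.

Let convE p q k : \sum_(i \in [set: int]) p i * q (k - i) =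
  \sum_(i <- supp p) p i * q (k - i).
Proof. by apply: fsbigTE => i /supp0 ->; rewrite mul0r. Qed.

Let conv0 p q k : k \notin conv_supp p q ->
  \sum_(i \in [set: int]) p i * q (k - i) = 0.
Proof.
move=> h; rewrite convE big_seq big1 // => i hi.
by rewrite (conv_supp0 h hi) mulr0.
Qed.

Program Definition laurent0 := @Laurent (fun=> 0) _.
Next Obligation. exact: (@fin fset0). Qed.

Program Definition laurent1 := @Laurent (fun i => (i == 0)%:R) _.
Next Obligation.
by apply: (@fin [fset 0]%fset) => i; rewrite inE => /negbTE ->.
Qed.

Program Definition laurent_opp p := @Laurent (fun i => - p i) _.
Next Obligation.
by move=> p; apply: (@fin (supp p)) => i /supp0 ->; rewrite oppr0.
Qed.

Program Definition laurent_add p q := @Laurent (fun i => p i + q i) _.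
Next Obligation.
move=> p q; apply: (@fin (supp p `|` supp q)%fset) => i.
by rewrite inE negb_or => /andP[/supp0 -> /supp0 ->]; rewrite addr0.
Qed.

Program Definition laurent_mul p q :=
  @Laurent (fun k => \sum_(i \in [set: int]) p i * q (k - i)) _.
Next Obligation.
by move=> p q; apply: (@fin (conv_supp p q)) => k; exact: conv0.
Qed.

Let addA : associative laurent_add.
Proof. by move=> p q r; apply/laurentP => i /=; rewrite addrA. Qed.
Let addC : commutative laurent_add.
Proof. by move=> p q; apply/laurentP => i /=; rewrite addrC. Qed.
Let add0 : left_id laurent0 laurent_add.
Proof. by move=> p; apply/laurentP => i /=; rewrite add0r. Qed.
Let addN : left_inverse laurent0 laurent_opp laurent_add.
Proof. by move=> p; apply/laurentP => i /=; rewrite addNr. Qed.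
HB.instance Definition _ := GRing.isZmodule.Build laurent addA addC add0 addN.

Let shiftK (i : int) : bijective (fun j : int => j + i).
Proof. by exists (fun j => j - i) => j; rewrite ?addrK ?subrK. Qed.

Let mulA : associative laurent_mul.
Proof.
move=> p q r; apply/esym/laurentP => k /=.
rewrite (fsbigTE (conv_supp p q)); last first.
  by move=> m /conv0 ->; rewrite mul0r.
under [LHS]eq_bigr do rewrite convE mulr_suml.
rewrite exchange_big /= [RHS](fsbigTE (supp p)); last by move=> i /supp0 ->; rewrite mul0r.
rewrite big_seq [RHS]big_seq.
apply: eq_bigr => i hi.
rewrite -(fsbigTE _ (fun m => p i * q (m - i) * r (k - m))); last first.
  by move=> m hm; rewrite (conv_supp0 hm hi) mulr0 mul0r.
rewrite (reindex_fsbigT (fun j => j + i)) //.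
rewrite convE (fsbigTE (supp q)); last first.
  by move=> j /supp0 hj; rewrite addrK hj mulr0 mul0r.
rewrite mulr_sumr; apply: eq_bigr => j _.
by rewrite addrK mulrA opprD addrA addrAC.
Qed.

Let mul1 : left_id laurent1 laurent_mul.
Proof.
move=> p; apply/laurentP => k /=.
rewrite (fsbigTE [fset 0]%fset).
  by rewrite big_seq_fset1 eqxx mul1r subr0.
by move=> i; rewrite inE => /negbTE ->; rewrite mul0r.
Qed.

Let mul1p : right_id laurent1 laurent_mul.
Proof.
move=> p; apply/laurentP => k /=.
rewrite (fsbigTE [fset k]%fset).
  by rewrite big_seq_fset1 subrr eqxx mulr1.
by move=> i; rewrite inE eq_sym -subr_eq0 => /negbTE ->; rewrite mulr0.
Qed.

Let mulDl : left_distributive laurent_mul laurent_add.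
Proof.
move=> p q r; apply/laurentP => k /=.
rewrite !(fsbigTE (supp p `|` supp q)%fset) /=.
- by rewrite -big_split; apply: eq_bigr => i _; rewrite mulrDl.
- by move=> i; rewrite inE negb_or => /andP[_ /supp0 ->]; rewrite mul0r.
- by move=> i; rewrite inE negb_or => /andP[/supp0 -> _]; rewrite mul0r.
- move=> i; rewrite inE negb_or => /andP[/supp0 -> /supp0 ->].
  by rewrite addr0 mul0r.
Qed.

Let mulDr : right_distributive laurent_mul laurent_add.
Proof.
move=> p q r; apply/laurentP => k /=.
rewrite !convE -big_split (fsbigTE (supp p)).
  by apply: eq_bigr => i _ /=; rewrite mulrDr.
by move=> i /supp0 ->; rewrite mul0r.
Qed.

HB.instance Definition _ :=
  GRing.Zmodule_isPzRing.Build laurent mulA mul1 mul1p mulDl mulDr.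

Lemma lcoefD p q i : (p + q) i = p i + q i. Proof. by []. Qed.
Lemma lcoefN p i : (- p) i = - p i. Proof. by []. Qed.
Lemma lcoef0 i : (0 : laurent) i = 0. Proof. by []. Qed.
Lemma lcoef1 i : (1 : laurent) i = (i == 0)%:R. Proof. by []. Qed.
Lemma lcoefM p q k : (p * q) k = \sum_(i \in [set: int]) p i * q (k - i).
Proof. by []. Qed.

Lemma lcoefM_ind (P : set S) p q :
  P 0 -> (forall a b, P a -> P b -> P (a + b)) ->
  (forall a b, P a -> P b -> P (a * b)) ->
  (forall i, P (p i)) -> (forall i, P (q i)) -> forall i, P ((p * q) i).
Proof.
move=> P0 PD PM Pp Pq k; rewrite lcoefM convE.
by apply: big_ind => // i _; exact: PM.
Qed.

Definition sum_coef p := \sum_(i \in [set: int]) p i.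

Lemma sum_coef1 : sum_coef 1 = 1.
Proof.
rewrite /sum_coef (fsbigTE [fset 0]%fset).
  by rewrite big_seq_fset1.
by move=> i; rewrite inE lcoef1 => /negbTE ->.
Qed.

Lemma sum_coefM p q : sum_coef (p * q) = sum_coef p * sum_coef q.
Proof.
rewrite /sum_coef (fsbigTE (conv_supp p q)); last by move=> k /conv0.
rewrite [in RHS](fsbigTE (supp p)); last exact: supp0.
under eq_bigr do rewrite lcoefM convE.
rewrite exchange_big /= mulr_suml big_seq [RHS]big_seq.
apply: eq_bigr => i hi.
rewrite -(fsbigTE _ (fun m => p i * q (m - i))); last first.
  by move=> m hm; rewrite (conv_supp0 hm hi) mulr0.
rewrite (reindex_fsbigT (fun j => j + i)) //.
rewrite (fsbigTE (supp q)); last first.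
  by move=> j /supp0 hj; rewrite addrK hj mulr0.
rewrite (fsbigTE (supp q)); last exact: supp0.
by rewrite mulr_sumr; apply: eq_bigr => j _; rewrite addrK.
Qed.

End Laurent.

Section Paraunitary.
Variables (R : realType) (H : hilbertType R).
Local Notation L := (laurent (bop H)).
Implicit Types p q : L.

Program Definition star p : L := @Laurent _ (fun i => adj (p (- i))) _.
Next Obligation.
move=> p; apply: (@sub_finite_set _ _ (-%R @` [set i | p i <> 0])).
  move=> i /= h; exists (- i); last by rewrite opprK.
  by apply: contra_not h => ->; rewrite adj0.
by apply: finite_image; exact: lcoef_finite.
Qed.

Lemma starE p i : star p i = adj (p (- i)). Proof. by []. Qed.

Lemma starK : involutive star.
Proof. by move=> p; apply/laurentP => i; rewrite !starE opprK adjK. Qed.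

Lemma star1 : star 1 = 1.
Proof.
apply/laurentP => i; rewrite starE !lcoef1 oppr_eq0.
by case: eqP => _; rewrite ?adj1 ?adj0.
Qed.

Lemma adj_fsum (f : int -> bop H) :
  finite_set [set i | f i <> 0] ->
  adj (\sum_(i \in [set: int]) f i) = \sum_(i \in [set: int]) adj (f i).
Proof.
move=> ff.
have h i : i \notin fset_set [set i | f i <> 0] -> f i = 0.
  by rewrite in_fset_set // notin_setE /= => /contrapT.
rewrite (fsbigTE (fset_set [set i | f i <> 0])) // [RHS](fsbigTE (fset_set [set i | f i <> 0])); last first.
  by move=> i /h ->; rewrite adj0.
by elim/big_rec2: _ => [|i x y _ <-]; [exact: adj0|exact: adjD].
Qed.

Lemma starM p q : star (p * q) = star q * star p.
Proof.
apply/laurentP => k; rewrite starE !lcoefM adj_fsum; last first.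
  apply: sub_finite_set (@lcoef_finite _ p) => i /=.
  by apply: contra_not => ->; rewrite mul0r.
rewrite [RHS](reindex_fsbigT (fun i => k + i)); last first.
  by exists (fun i => i - k) => i; rewrite ?subrKC // addrC addKr.
apply: eq_fsbigr => i _; rewrite adjM !starE; congr (adj (q _) * adj (p _)).
  by rewrite opprD.
by rewrite opprB addrAC subrr add0r.
Qed.

Lemma sum_coef_star p : sum_coef (star p) = adj (sum_coef p).
Proof.
rewrite /sum_coef adj_fsum; last exact: lcoef_finite.
rewrite (reindex_fsbigT -%R); last by exists -%R; exact: opprK.
by apply: eq_fsbigr => i _; rewrite starE opprK.
Qed.

(* A[t,t^-1] is the set of Laurent polynomials over all bounded operators whose
   coefficients lie in A. *)
Record ppu (A : von_neumann_algebra H) := PPU {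
  ppu_val :> L;
  ppu_coef : forall i, vna_set A (ppu_val i);
  ppu_starl : star ppu_val * ppu_val = 1;
  ppu_starr : ppu_val * star ppu_val = 1;
  ppu_sum : sum_coef ppu_val = 1 }.

Section Group.
Variable A : von_neumann_algebra H.
HB.instance Definition _ := gen_eqMixin (ppu A).
HB.instance Definition _ := gen_choiceMixin (ppu A).

Lemma ppuP (p q : ppu A) : p = q <-> ppu_val p = ppu_val q.
Proof.
split=> [->//|]; case: p q => [p p1 p2 p3 p4] [q q1 q2 q3 q4] /= pq.
by subst q; congr PPU; exact: Prop_irrelevance.
Qed.

Program Definition ppu1 : ppu A := @PPU A 1 _ _ _ _.
Next Obligation.
move=> i; rewrite lcoef1; case: eqP => _; [exact: vna1|exact: vna0].
Qed.
Next Obligation. by rewrite star1 mulr1. Qed.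
Next Obligation. by rewrite star1 mulr1. Qed.
Next Obligation. exact: sum_coef1. Qed.

Program Definition ppu_inv (p : ppu A) : ppu A := @PPU A (star p) _ _ _ _.
Next Obligation. by move=> p i; apply: vna_adj; exact: ppu_coef. Qed.
Next Obligation. by move=> p; rewrite starK ppu_starr. Qed.
Next Obligation. by move=> p; rewrite starK ppu_starl. Qed.
Next Obligation.
by move=> p; rewrite sum_coef_star ppu_sum adj1.
Qed.

Program Definition ppu_mul (p q : ppu A) : ppu A :=
  @PPU A (ppu_val p * ppu_val q) _ _ _ _.
Next Obligation.
move=> p q; apply: lcoefM_ind; [exact: vna0|exact: vnaD|exact: vnaM|..].
  exact: ppu_coef.
exact: ppu_coef.
Qed.
Next Obligation.
by move=> p q; rewrite starM -mulrA [X in _ * X]mulrA ppu_starl mul1r ppu_starl.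
Qed.
Next Obligation.
by move=> p q; rewrite starM -mulrA [X in _ * X]mulrA ppu_starr mul1r ppu_starr.
Qed.
Next Obligation.
by move=> p q; rewrite sum_coefM !ppu_sum mulr1.
Qed.

Let mulA : associative ppu_mul.
Proof. by move=> p q r; apply/ppuP; rewrite /= mulrA. Qed.
Let mul1 : left_id ppu1 ppu_mul.
Proof. by move=> p; apply/ppuP; rewrite /= mul1r. Qed.
Let mulr1' : right_id ppu1 ppu_mul.
Proof. by move=> p; apply/ppuP; rewrite /= mulr1. Qed.
Let mulV : left_inverse ppu1 ppu_inv ppu_mul.
Proof. by move=> p; apply/ppuP; rewrite /= ppu_starl. Qed.
Let mulV' : right_inverse ppu1 ppu_inv ppu_mul.
Proof. by move=> p; apply/ppuP; rewrite /= ppu_starr. Qed.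
HB.instance Definition _ := isGroup.Build (ppu A) mulA mul1 mulr1' mulV mulV'.

(* The elements of PPU(A) that lie in A[t] *)
Definition ppu_plus : set (ppu A) := [set p | forall i : int, i < 0 -> p i = 0].

Definition ppu_le (p q : ppu A) : Prop := ppu_plus (q * p^-1)%g.

Lemma ppu_le_mulr (p q r : ppu A) : ppu_le p q -> ppu_le (p * r)%g (q * r)%g.
Proof. by rewrite /ppu_le invgM mulgA mulgK. Qed.
End Group.
End Paraunitary.

Section Lattice.
Variables (T : Type) (le : T -> T -> Prop).

Definition is_partial_order := [/\ forall x, le x x,
  forall x y, le x y -> le y x -> x = y &
  forall x y z, le x y -> le y z -> le x z].

Definition is_meet x y m :=
  [/\ le m x, le m y & forall z, le z x -> le z y -> le z m].

Definition is_join x y j :=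
  [/\ le x j, le y j & forall z, le x z -> le y z -> le j z].

Definition is_lattice_order :=
  is_partial_order /\
  forall x y, (exists m, is_meet x y m) /\ (exists j, is_join x y j).
End Lattice.

(* Main.v *)
Require Import Defs.
From HB Require Import structures.
From mathcomp Require Import all_boot all_order all_algebra.
From mathcomp Require Import finmap complex zify ring lra.
From mathcomp Require Import all_classical all_reals all_analysis.

Set Implicit Arguments.
Unset Strict Implicit.
Unset Printing Implicit Defensive.

Import Order.TTheory GRing.Theory Num.Theory numFieldNormedType.Exports.
Local Open Scope classical_set_scope.
Local Open Scope ring_scope.
Local Open Scope complex_scope.

(** Elements of PPU(A) act on H-valued sequences f : int -> H, read as formal
    series in t, by convolution.  Attach to p the space M_p of all f such that
    p f vanishes in negative degrees, that is M_p = p^-1 H[[t]].  Then p <= q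
    holds iff M_p is contained in M_q, so an m such that M_m is the
    intersection of M_p and M_q is a greatest lower bound of p and q.

    Such an m exists by a finite form of the theorem of Beurling and Lax
    ([beurling_lax]).  Let M be a closed space of series that is stable under t
    and under the commutant of A and satisfies
    t^n H[[t]] <= M <= t^-n H[[t]].  Put W = M - tM (orthogonal difference),
    the space of wandering vectors.  Three facts make W a copy of H.
    - Orthogonal projection gives M = W + tM ([wandering_decomposition]);
      projections come from completeness of H ([projection]).
    - Distinct translates t^j W and t^k W are orthogonal.  Setting t = 1, that
      is w |-> sum_i w_i, therefore preserves the inner product on W: expanding
      the inner product of two values at t = 1 gives the sum over k of the
      inner products of t^k w with w', and only k = 0 survives
      ([dot_ev_wandering]).
    - Iterating the decomposition on t^n h for h in H must stop, because t^n h
      is orthogonal to t^(2n+1) M.  So t^n h is a finite sum of translates of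
      wandering vectors ([wandering_span]), and evaluation at t = 1 maps W onto
      H ([wandering_exists]).
    The inverse of the evaluation sends h to a series with coefficients
    theta_i h.  Orthogonality of the translates says theta* theta = 1, the
    spanning property says theta theta* = 1, and sum_i theta_i = 1 by
    construction.  Uniqueness of the wandering vector with a given value makes
    theta_i commute with the commutant of A, so theta_i lies in A by the
    bicommutant property.  Then m = theta^-1 is the desired element.

    Least upper bounds follow from greatest lower bounds, as the substitution
    t |-> t^-1 is an order-reversing involution of PPU(A) ([ppu_le_rev]).
    Antisymmetry is where the normalisation at t = 1 enters: a p in PPU(A)
    such that both p and its inverse are polynomials in t is constant, hence
    equal to the value 1 that it takes at t = 1. *)

(** * Finitely supported families indexed by the integers *)

Definition window (n : nat) : {fset int} :=
  [fset (i%:Z - n%:Z) | i in iota 0 n.*2.+1]%fset.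

Lemma mem_window n (i : int) : (i \in window n) = (`|i| <= n)%N.
Proof.
apply/imfsetP/idP => [[j hj ->]|h].
  by have : j \in iota 0 n.*2.+1 by []; rewrite mem_iota; lia.
exists (absz (i + n%:Z)); last by lia.
by change (absz (i + n%:Z) \in iota 0 n.*2.+1); rewrite mem_iota; lia.
Qed.

Lemma window0 : window 0 = [fset 0]%fset.
Proof. by apply/fsetP => i; rewrite mem_window inE; lia. Qed.

Definition supported n (T : nmodType) (f : int -> T) :=
  forall i, (n < `|i|)%N -> f i = 0.

Lemma fsum_window (T : nmodType) n (f : int -> T) : supported n f ->
  \sum_(i \in [set: int]) f i = \sum_(i <- window n) f i.
Proof. by move=> h; apply: fsbigTE => i; rewrite mem_window -ltnNge => /h. Qed.

Lemma laurent_supported (S : pzRingType) (p : laurent S) :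
  exists n, supported n p.
Proof.
pose F := fset_set [set i | p i <> 0].
exists (\max_(i <- F) `|i|%N) => i; rewrite ltnNge; apply: contraNeq => /eqP pi.
apply: (@leq_bigmax_seq _ _ _ (fun i : int => `|i|%N)) => //.
by rewrite in_fset_set ?inE //; exact: lcoef_finite.
Qed.


Lemma supportedW (T : nmodType) m n (f : int -> T) :
  (m <= n)%N -> supported m f -> supported n f.
Proof. by move=> mn hf i hi; apply: hf; exact: leq_ltn_trans hi. Qed.

Lemma fsum_shift (T : nmodType) (f : int -> T) (z : int) :
  \sum_(i \in [set: int]) f (i + z) = \sum_(i \in [set: int]) f i.
Proof.
apply/esym; apply: (@reindex_fsbigT _ _ _ _ _ (fun i => i + z)).
by exists (fun i => i - z) => i; rewrite ?addrK ?subrK.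
Qed.

(** * Laurent polynomials acting on H-valued series *)

Section Action.
Variables (R : realType) (H : hilbertType R).
Local Notation L := (laurent (bop H)).
Local Notation V := (int -> H).
Implicit Types (p q : L) (f g : V) (h : H) (z : int).

Lemma bop_sumE (I : Type) (s : seq I) (F : I -> bop H) h :
  (\sum_(i <- s) F i) h = \sum_(i <- s) F i h.
Proof. by elim/big_rec2: _ => [//|i x y _ <-]. Qed.

(** The sequences are not required to have finite support: the convolution with
    a Laurent polynomial is a finite sum in every degree. *)
Definition act p f : V := fun k => \sum_(i \in [set: int]) p i (f (k - i)).

(** The product of p with the constant series h. *)
Definition lapply p h : V := fun i => p i h.

(** Multiplication by t^z. *)
Definition tshift z f : V := fun i => f (i - z).

Lemma tshift0 f : tshift 0 f = f.
Proof. by apply/funext => i; rewrite /tshift subr0. Qed.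

Lemma tshiftD (a b : int) f : tshift a (tshift b f) = tshift (a + b) f.
Proof. by apply/funext => i; rewrite /tshift opprD addrA. Qed.

(** The vector h as a constant series. *)
Definition delta h : V := fun i => if i == 0 then h else 0.

Lemma actE n p f k : supported n p ->
  act p f k = \sum_(i <- window n) p i (f (k - i)).
Proof. by move=> hp; apply: fsum_window => i /hp ->. Qed.

Lemma act_lin p (a : R[i]) f g :
  act p (fun i => a *: f i + g i) = (fun k => a *: act p f k + act p g k).
Proof.
have [n hn] := laurent_supported p; apply/funext => k.
rewrite !(actE _ _ hn) scaler_sumr -big_split.
by apply: eq_bigr => i _; rewrite linearP.
Qed.

Lemma act0 p : act p (fun=> 0) = fun=> 0.
Proof.
have [n hn] := laurent_supported p; apply/funext => k.
by rewrite (actE _ _ hn) big1 // => i _; rewrite linear0.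
Qed.

Lemma act_shift p z f : act p (tshift z f) = tshift z (act p f).
Proof.
by apply/funext => k; apply: eq_fsbigr => i _; rewrite /tshift addrAC.
Qed.

Lemma act_lapply p q h : act p (lapply q h) = lapply (p * q) h.
Proof.
have [n hn] := laurent_supported p; apply/funext => k.
rewrite (actE _ _ hn) /lapply lcoefM (@fsum_window _ n) ?bop_sumE // => i.
by move=> /hn ->; rewrite mul0r.
Qed.

Lemma act_shift_delta p z h : act p (tshift z (delta h)) = tshift z (lapply p h).
Proof.
rewrite act_shift; congr tshift; apply/funext => k.
have -> : delta h = lapply 1 h.
  by apply/funext => i; rewrite /lapply lcoef1 /delta; case: eqP.
by rewrite act_lapply mulr1.
Qed.

Lemma act_mul p q f : act (p * q) f = act p (act q f).
Proof.
have [a ha] := laurent_supported p; have [b hb] := laurent_supported q.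
apply/funext => k.
have E m : (p * q) m = \sum_(i <- window a) p i * q (m - i).
  by rewrite lcoefM (@fsum_window _ a) // => i /ha ->; rewrite mul0r.
have hab : supported (a + b) (p * q).
  move=> m hm; rewrite E big_seq big1 // => i; rewrite mem_window => hi.
  by rewrite hb ?mulr0 //; lia.
rewrite (actE _ _ hab) (actE _ _ ha).
under eq_bigr do rewrite E bop_sumE.
rewrite exchange_big big_seq [RHS]big_seq; apply: eq_bigr => i.
rewrite mem_window => hi.
rewrite -linear_sum -(@fsum_window _ _ (fun m => q (m - i) (f (k - m)))).
  congr (p i _); rewrite -[LHS](fsum_shift _ i); apply: eq_fsbigr => j _.
  by rewrite addrK opprD addrA addrAC.
by move=> m hm; rewrite hb //; lia.
Qed.

Lemma act1 f : act 1 f = f.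
Proof.
have h : supported 0 (1 : L) by move=> i; rewrite lcoef1; case: eqP => // ->.
apply/funext => k; rewrite (actE _ _ h) window0.
by rewrite big_seq_fset1 subr0.
Qed.

Lemma act_bop p (b : bop H) f : (forall i, b * p i = p i * b) ->
  act p (fun i => b (f i)) = fun k => b (act p f k).
Proof.
have [n hn] := laurent_supported p; move=> bp; apply/funext => k.
rewrite !(actE _ _ hn) linear_sum; apply: eq_bigr => i _.
by rewrite -[RHS]bopME bp.
Qed.

(** The inner product of l^2(Z, H), meaningful as soon as one of the two
    arguments has finite support.  Summing over all integers makes its
    invariance under translation unconditional. *)
Definition fdot f g : R[i] := \sum_(i \in [set: int]) dotH (f i) (g i).

Lemma dot0l (x : H) : dotH 0 x = 0.
Proof. by rewrite -(scale0r (0 : H)) dotZl mul0r. Qed.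

Lemma dot0r (x : H) : dotH x 0 = 0.
Proof. by rewrite dotC dot0l rmorph0. Qed.

Lemma fdotEl n f g : supported n f ->
  fdot f g = \sum_(i <- window n) dotH (f i) (g i).
Proof. by move=> h; apply: fsum_window => i /h ->; rewrite dot0l. Qed.

Lemma fdotEr n f g : supported n g ->
  fdot f g = \sum_(i <- window n) dotH (f i) (g i).
Proof. by move=> h; apply: fsum_window => i /h ->; rewrite dot0r. Qed.

Lemma fdotC n f g : supported n g -> fdot g f = (fdot f g)^*%R.
Proof.
move=> h; rewrite (fdotEl _ h) (fdotEr _ h) rmorph_sum.
by apply: eq_bigr => i _; exact: dotC.
Qed.

Lemma fdot_linr n (a : R[i]) f g g' : supported n g -> supported n g' ->
  fdot f (fun i => a *: g i + g' i) = a^*%R * fdot f g + fdot f g'.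
Proof.
move=> gs gs'; rewrite (fdotEr _ gs) (fdotEr _ gs') (@fdotEr n).
  by rewrite mulr_sumr -big_split; apply: eq_bigr => i _; rewrite dotDr dotZr.
by move=> i hi; rewrite gs // gs' // scaler0 addr0.
Qed.

Lemma fdot_shift z f g : fdot (tshift z f) g = fdot f (tshift (- z) g).
Proof.
rewrite /fdot -[LHS](fsum_shift _ z).
by apply: eq_fsbigr => i _; rewrite /tshift addrK opprK.
Qed.

Lemma fdot_bop (b : bop H) f g :
  fdot (fun i => b (f i)) g = fdot f (fun i => adj b (g i)).
Proof. by apply: eq_fsbigr => i _; rewrite adjP. Qed.

Lemma dot_ge0 (x : H) : 0 <= dotH x x.
Proof. by rewrite dot_normE exprn_ge0. Qed.

Lemma dot_eq0 (x : H) : dotH x x = 0 -> x = 0.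
Proof. by rewrite dot_normE => /eqP; rewrite sqrf_eq0 normr_eq0 => /eqP. Qed.

Lemma fdot_ge n f i : supported n f -> dotH (f i) (f i) <= fdot f f.
Proof.
move=> h; rewrite (fdotEl _ h).
case: (leqP `|i|%N n) => [hi|/h ->]; last first.
  by rewrite dot0l sumr_ge0 // => j _; exact: dot_ge0.
rewrite (big_rem i) ?mem_window //= lerDl.
by apply: sumr_ge0 => j _; exact: dot_ge0.
Qed.

Lemma fdot_eq0 n f : supported n f -> fdot f f = 0 -> f = fun=> 0.
Proof.
move=> h f0; apply/funext => i; apply: dot_eq0; apply/le_anti.
by rewrite dot_ge0 andbT -f0; exact: fdot_ge h.
Qed.

(** The adjoint of f |-> p f for the inner product is f |-> p^* f; the pairing
    against h in degree k only involves the translate t^k p h. *)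
Lemma dot_act_star p f k h :
  dotH (act (star p) f k) h = fdot (tshift (- k) f) (lapply p h).
Proof.
have [n hn] := laurent_supported p.
have hs : supported n (star p).
  by move=> i hi; rewrite starE hn ?adj0 // abszN.
have hc : supported n (lapply p h) by move=> i /hn; rewrite /lapply => ->.
rewrite (actE _ _ hs) (fdotEr _ hc).
rewrite -(@fsum_window _ _ (fun i => star p i (f (k - i)))); last first.
  by move=> i /hs ->.
rewrite (reindex_fsbigT -%R); last by exists -%R; exact: opprK.
rewrite (@fsum_window _ n); last by move=> i hi; rewrite hs ?abszN.
elim: {hs hc hn} (enum_fset (window n)) => [|i s IH].
  by rewrite !big_nil dot0l.
rewrite !big_cons dotDl IH; congr (_ + _).
by rewrite starE opprK /tshift opprK addrC adjP adjK.
Qed.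

End Action.

(** * Orthogonal projection *)

Section Projection.
Variables (R : realType) (H : hilbertType R).

Let small (c r : R[i]) : 0 <= c -> 0 < r ->
  \forall n \near \oo, (n.+1%:R^-1 : R)%:C * c < r.
Proof.
move=> c0 r0; have c1 : 0 < c + 1 by rewrite ltr_wpDl ?ltr01.
have s0 : 0 < r / (c + 1) by rewrite divr_gt0.
have s1 : 0 < complex.Re (r / (c + 1)).
  by rewrite -ltcR RRe_real // gtr0_real.
near=> n; have : (n.+1%:R^-1 : R)%:C < r / (c + 1).
  rewrite -(RRe_real (gtr0_real s0)) ltcR.
  by near: n; exact: (near_infty_natSinv_lt (PosNum s1)).
rewrite ltr_pdivlMr // mulrDr mulr1; apply: le_lt_trans.
by rewrite lerDl lecR invr_ge0 ler0n.
Unshelve. all: by end_near.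
Qed.

Let cvg_small (T : normedModType R[i]) (c : R[i]) (u : nat -> T) (l : T) :
  0 <= c -> (forall n, `|l - u n| ^+ 2 <= (n.+1%:R^-1 : R)%:C * c) ->
  u @ \oo --> l.
Proof.
move=> c0 h; apply/cvgrPdist_lt => r r0; near=> n.
rewrite -(ltr_pXn2r (_ : 0 < 2)%N) ?nnegrE ?normr_ge0 ?(ltW r0) //.
by apply: le_lt_trans (h n) _; near: n; apply: small; rewrite ?exprn_gt0.
Unshelve. all: by end_near.
Qed.

Lemma cvg_dot (x y : H) (u : nat -> H) :
  u @ \oo --> y -> (fun n => dotH x (u n)) @ \oo --> dotH x y.
Proof.
move=> uy; apply/cvgrPdist_lt => r r0.
have x1 : 0 < `|x| + 1 by rewrite ltr_wpDl.
have /cvgrPdist_lt /(_ (r / (`|x| + 1))) := uy.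
rewrite divr_gt0 // => /(_ isT); apply: filterS => n.
rewrite ltr_pdivlMr // => h; rewrite -dotBr.
apply: le_lt_trans (dot_cauchy_schwarz _ _) _; apply: le_lt_trans h.
by rewrite mulrC ler_wpM2l // lerDl.
Qed.

Variables (I : eqType) (s : seq I) (K : set (I -> H)).
Hypothesis K0 : K (fun=> 0).
Hypothesis Klin : forall (a : R[i]) f g,
  K f -> K g -> K (fun i => a *: f i + g i).
Hypothesis Ks : forall f i, K f -> i \notin s -> f i = 0.
Hypothesis Kcl : forall (u : nat -> I -> H) f,
  (forall n, K (u n)) -> (forall i, (fun n => u n i) @ \oo --> f i) -> K f.

Let sdot (f g : I -> H) : R[i] := \sum_(i <- s) dotH (f i) (g i).

Let sdot_linl (a : R[i]) f g h :
  sdot (fun i => a *: f i + g i) h = a * sdot f h + sdot g h.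
Proof.
rewrite /sdot mulr_sumr -big_split; apply: eq_bigr => i _.
by rewrite dotDl dotZl.
Qed.

Let sdotC f g : sdot g f = (sdot f g)^*%R.
Proof. by rewrite /sdot rmorph_sum; apply: eq_bigr => i _; exact: dotC. Qed.

Let sdot_ge0 f : 0 <= sdot f f.
Proof. by apply: sumr_ge0 => i _; rewrite dot_normE exprn_ge0. Qed.

Let sdot_ge f i : i \in s -> `|f i| ^+ 2 <= sdot f f.
Proof.
move=> hi; rewrite /sdot (big_rem i) //= dot_normE lerDl.
by apply: sumr_ge0 => j _; rewrite dot_normE exprn_ge0.
Qed.

Let sdot_sub (v f g : I -> H) :
  sdot v (fun i => f i - g i) = sdot v f - sdot v g.
Proof. by rewrite /sdot -sumrB; apply: eq_bigr => i _; rewrite dotBr. Qed.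

Variable x : I -> H.
Let res (u : I -> H) := fun i => x i - u i.
Let J u : R := complex.Re (sdot (res u) (res u)).

Let JE u : (J u)%:C = sdot (res u) (res u).
Proof. by rewrite /J RRe_real // ger0_real. Qed.

Let J_has_inf : has_inf [set J u | u in K].
Proof.
split; first by exists (J (fun=> 0)); exists (fun=> 0).
by exists 0 => _ [u _ <-]; rewrite -lecR JE; exact: sdot_ge0.
Qed.

Let d := inf [set J u | u in K].

(* Moving from u in the direction v decreases the squared distance to x by
   |<v, x - u>|^2 / <v, v> at the optimal step c, and the squared distance is
   never below d. *)
Let sdot_res u v e : K u -> K v -> J u < d + e ->
  `|sdot v (res u)| ^+ 2 <= e%:C * sdot v v.
Proof.
move=> Ku Kv Jue; set b := sdot v (res u); set q := sdot v v.
have [q0|q0] := eqVneq q 0.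
  suff -> : b = 0 by rewrite normr0 expr0n q0 mulr0.
  rewrite /b /sdot big_seq big1 // => i si.
  suff -> : v i = 0 by rewrite dot0l.
  apply: dot_eq0; apply/le_anti; rewrite dot_ge0 andbT -q0 dot_normE.
  exact: sdot_ge.
have qp : 0 < q by rewrite lt_def q0 sdot_ge0.
pose c := b^*%R / q.
have Ju' : (J (fun i => c *: v i + u i))%:C = (J u)%:C - `|b| ^+ 2 / q.
  rewrite !JE.
  have -> : res (fun i => c *: v i + u i) = (fun i => (- c) *: v i + res u i).
    by apply/funext => i; rewrite /res scaleNr opprD addrCA.
  rewrite sdot_linl !(sdotC (fun i => - c *: v i + res u i)) !sdot_linl.
  rewrite -/q -/b !rmorphD !rmorphM rmorphN /= -!sdotC -/b (sdotC v (res u)).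
  rewrite -/b /c normCK rmorphM /= conjCK fmorphV /= -(sdotC v v) -/q.
  by clear c qp; move: b q q0 (b^*%R) => b' q' q0 b''; field.
rewrite -ler_pdivrMr //.
have -> : `|b| ^+ 2 / q = (J u)%:C - (J (fun i => c *: v i + u i))%:C.
  by rewrite Ju' opprB addrC subrK.
rewrite -rmorphB lecR lerBlDr; apply: le_trans (ltW Jue) _.
rewrite addrC lerD2l; apply: ge_inf J_has_inf.2 _ _.
by exists (fun i => c *: v i + u i) => //; exact: Klin.
Qed.

(** Existence of the orthogonal projection of x on a closed subspace K of the
    Hilbert sum of finitely many copies of H.  A sequence in K whose distance
    to x tends to the infimum is nearly orthogonal to K after subtraction from
    x; applied to differences of its own terms, this makes it a Cauchy sequence,
    and its limit is the projection. *)
Lemma projection :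
  exists2 k, K k & forall v, K v -> \sum_(i <- s) dotH (v i) (x i - k i) = 0.
Proof.
pose e n : R := n.+1%:R^-1.
have e0 n : 0 < e n by rewrite invr_gt0.
have /choice[u uP] : forall n, exists u, K u /\ J u < d + e n.
  move=> n; have [_ [u Ku <-] h] := inf_adherent (e0 n) J_has_inf.
  by exists u.
have uC m n i : `|u m i - u n i| ^+ 2 <= (2 * (e m + e n))%:C.
  have [si|si] := boolP (i \in s); last first.
    rewrite !Ks ?subrr ?normr0 ?expr0n ?lecR //; try exact: (uP _).1.
    by rewrite mulr_ge0 // addr_ge0 // ltW.
  pose v := fun i => u m i - u n i.
  have Kv : K v.
    rewrite (_ : v = fun i => -1 *: u n i + u m i).
      by apply: Klin; exact: (uP _).1.
    by apply/funext => j; rewrite scaleN1r addrC.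
  apply: le_trans (sdot_ge v si) _; set q := sdot v v.
  have [->|q0] := eqVneq q 0.
    by rewrite lecR mulr_ge0 // addr_ge0 // ltW.
  have qp : 0 < q by rewrite lt_def q0 sdot_ge0.
  (* With v = u m - u n, q = <v, x - u n> - <v, x - u m>, and the square of
     each term is at most q times e n or e m. *)
  rewrite -(ler_pM2r qp).
  have h1 := sdot_res (uP m).1 Kv (uP m).2.
  have h2 := sdot_res (uP n).1 Kv (uP n).2.
  have qE : q = sdot v (res (u n)) - sdot v (res (u m)).
    rewrite /q -sdot_sub; congr sdot; apply/funext => j.
    by rewrite /res /v opprB [RHS]addrC addrA subrK.
  rewrite -expr2 -{1}(ger0_norm (ltW qp)) {1}qE.
  move: (sdot v (res (u m))) (sdot v (res (u n))) h1 h2 => a b h1 h2.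
  rewrite -/q in h1 h2 *.
  have : `|b - a| ^+ 2 <= 2 * (`|b| ^+ 2 + `|a| ^+ 2).
    have h : `|b - a| ^+ 2 <= (`|b| + `|a|) ^+ 2.
      by rewrite ler_pXn2r ?nnegrE ?addr_ge0 // ler_normB.
    apply: le_trans h _; rewrite -subr_ge0.
    have -> : 2 * (`|b| ^+ 2 + `|a| ^+ 2) - (`|b| + `|a|) ^+ 2 =
      (`|b| - `|a|) ^+ 2 by ring.
    by rewrite -real_normK ?exprn_ge0 // rpredB // normr_real.
  move=> /le_trans -> //.
  rewrite rmorphM rmorph_nat rmorphD /= -mulrA ler_pM2l // mulrDl.
  by rewrite addrC lerD.
have uc i : cvg ((fun n => u n i) @ \oo).
  apply: cauchy_cvg; apply/cauchyP => r r0.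
  have [N _ NP] := small (ler0n _ 4) (exprn_gt0 2 r0).
  exists (u N i); exists N => // n /= Nn.
  rewrite -ball_normE /= -(ltr_pXn2r (_ : 0 < 2)%N) ?nnegrE ?normr_ge0 ?(ltW r0) //.
  apply: le_lt_trans (uC _ _ _) _; apply: le_lt_trans (NP N (leqnn N)).
  have -> : (4%:R : R[i]) = (4%:R : R)%:C by rewrite rmorph_nat.
  rewrite -rmorphM lecR -/(e N).
  have : e n <= e N by rewrite lef_pV2 ?posrE // ler_nat.
  by lra.
pose k i := lim ((fun n => u n i) @ \oo).
have Kk : K k by apply: Kcl uc => n; exact: (uP n).1.
exists k => // v Kv.
pose b n := sdot v (res (u n)).
have b0 : b @ \oo --> (0 : R[i]^o).
  apply: (@cvg_small R[i]^o (sdot v v)) => // n.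
  by rewrite sub0r normrN; apply: sdot_res => //; case: (uP n).
have bl : b @ \oo --> (sdot v (res k) : R[i]^o).
  rewrite /b /sdot; apply: (cvg_big (U := R[i]^o) add_continuous) => i _.
  apply: cvg_dot; apply: cvgB; [exact: cvg_cst|exact: uc].
have hausC : hausdorff_space R[i]^o := @norm_hausdorff _ R[i]^o.
exact: (cvg_unique hausC bl b0).
Qed.

End Projection.

(** * Wandering vectors *)

Lemma bop_of_contraction (R : realType) (H : hilbertType R) (f : H -> H) :
  linear f -> (forall x, `|f x| <= `|x|) -> exists b : bop H, bop_fun b = f.
Proof.
move=> lf f1.
pose lfi := GRing.isLinear.Build R[i] H H *:%R f lf.
pose F : {linear H -> H} := HB.pack f lfi.
have cf : continuous f.
  apply/(@linear_bounded_continuous _ _ _ F)/linear_boundedP.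
  exists 1; split; first exact: real1.
  by move=> r r1 x; apply: le_trans (f1 x) _; rewrite ler_peMl // ltW.
by exists (Bop lf cf).
Qed.

Section BeurlingLax.
Variables (R : realType) (H : hilbertType R) (A : von_neumann_algebra H).
Local Notation V := (int -> H).
Variables (n : nat) (M : set V).
Hypothesis Mlin : forall (a : R[i]) f g,
  M f -> M g -> M (fun i => a *: f i + g i).
Hypothesis Mshift1 : forall f, M f -> M (tshift 1 f).
Hypothesis Mlow : forall f i, M f -> i < - n%:Z -> f i = 0.
Hypothesis Mhigh : forall f, (forall i, i < n%:Z -> f i = 0) -> M f.
Hypothesis Mclosed : forall (u : nat -> V) f,
  (forall k, M (u k)) -> (forall i, (fun k => u k i) @ \oo --> f i) -> M f.
Hypothesis Mcomm : forall (b : bop H) f, commutant (vna_set A) b ->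
  M f -> M (fun i => b (f i)).

Let M0 : M (fun=> 0). Proof. exact: Mhigh. Qed.

Let MB f g : M f -> M g -> M (fun i => f i - g i).
Proof.
move=> Mf Mg; rewrite (_ : (fun=> _) = (fun i => -1 *: g i + f i)).
  exact: Mlin.
by apply/funext => i; rewrite scaleN1r addrC.
Qed.

Let Mshift k f : M f -> M (tshift k%:Z f).
Proof.
elim: k f => [|k IH] f Mf; first by rewrite tshift0.
by rewrite intS -tshiftD; apply: Mshift1; exact: IH.
Qed.

(** The orthogonal complement of tM in M.  Since tM contains t^(n+1) H[[t]] and
    M starts in degree -n, its elements have no degrees outside [-n, n];
    requiring this first gives a meaning to the inner product with an arbitrary
    series. *)
Definition wandering w :=
  [/\ M w, supported n w & forall m, M m -> fdot (tshift 1 m) w = 0].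

(* Truncation to the degrees of the window.  The tail of a series that vanishes
   below degree -n starts in degree n + 1, hence lies in tM. *)
Let trunc (f : V) : V := fun i => if (`|i| <= n)%N then f i else 0.

Let supp_trunc f : supported n (trunc f).
Proof. by move=> i; rewrite /trunc ltnNge => /negbTE ->. Qed.

Let M_tail f : (forall i, i < - n%:Z -> f i = 0) ->
  M (tshift (-1) (fun i => f i - trunc f i)).
Proof.
move=> hf; apply: Mhigh => i hi; rewrite /tshift /trunc.
by case: ifP => h; rewrite ?subrr // hf ?subr0 //; lia.
Qed.

(** Since t^(n+1) H[[t]] is contained in tM, the splitting M = W + tM takes
    place in the finitely many degrees between -n and n: truncate m and project
    it on the part K of tM that lives in these degrees. *)
Lemma wandering_decomposition m : M m ->
  exists w m', [/\ wandering w, M m' & m = fun i => w i + tshift 1 m' i].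
Proof.
move=> Mm.
pose K := [set f : V | supported n f /\ M (tshift (-1) f)].
have [||||k [ks kM] kP] := @projection _ _ _ (window n) K _ _ _ _ m.
- by split=> //; exact: M0.
- move=> a f g [fs fM] [gs gM]; split; last exact: Mlin fM gM.
  by move=> i hi; rewrite fs // gs // scaler0 addr0.
- by move=> f i [fs _]; rewrite mem_window -ltnNge => /fs.
- move=> u f Ku uf; split; last first.
    apply: (@Mclosed (fun k => tshift (-1) (u k))) => [k|i].
      by have [] := Ku k.
    exact: uf.
  move=> i hi; have hausH : hausdorff_space H := @norm_hausdorff _ H.
  apply: (cvg_unique hausH (uf i)).
  rewrite (_ : (fun k => u k i) = fun=> 0); first exact: cvg_cst.
  by apply/funext => k; exact: (Ku k).1.
pose w := trunc (fun i => m i - k i).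
have ws : supported n w by exact: supp_trunc.
have Mm' : M (tshift (-1) (fun i => m i - w i)).
  rewrite (_ : tshift _ _ = fun i => 1 *: tshift (-1) k i +
    tshift (-1) (fun i => m i - trunc m i) i).
    by apply: Mlin kM _; apply: M_tail => i; exact: Mlow.
  apply/funext => i; rewrite scale1r /tshift /w /trunc.
  case: leqP => h; first by rewrite subrr addr0 subKr.
  by rewrite (ks _ h) add0r.
have Ew : m = fun i => w i + tshift 1 (tshift (-1) (fun i => m i - w i)) i.
  by rewrite tshiftD subrr tshift0; apply/funext => i; rewrite addrC subrK.
exists w, (tshift (-1) (fun i => m i - w i)); split=> //; split=> //.
  rewrite (_ : w = fun i => m i - tshift 1 (tshift (-1) (fun i => m i - w i)) i).
    by apply: MB => //; exact: Mshift1.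
  by rewrite tshiftD subrr tshift0; apply/funext => i; rewrite subKr.
move=> m'' Mm''.
have Kv : K (trunc (tshift 1 m'')).
  split; first exact: supp_trunc.
  rewrite (_ : tshift _ _ = fun i => m'' i -
    tshift (-1) (fun i => tshift 1 m'' i - trunc (tshift 1 m'') i) i).
    apply: MB => //; apply: M_tail => i hi; apply: (Mlow Mm''); lia.
  by apply/funext => i; rewrite /tshift opprK addrK subKr.
rewrite (fdotEr _ ws) -[RHS](kP _ Kv) big_seq [RHS]big_seq.
by apply: eq_bigr => i; rewrite mem_window /w /trunc => ->.
Qed.

Lemma wandering_shift (w w' : V) (z : int) : wandering w -> wandering w' ->
  z != 0 -> fdot (tshift z w) w' = 0.
Proof.
have pos k u v : wandering u -> wandering v -> fdot (tshift k.+1%:Z u) v = 0.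
  by move=> [Mu _ _] [_ _ hv]; rewrite intS -tshiftD; apply: hv; exact: Mshift.
move=> Ww Ww'; case: z => [[//|k] _|k _]; first exact: pos.
rewrite fdot_shift NegzE opprK (@fdotC _ _ n) ?pos ?rmorph0 //.
by case: Ww.
Qed.


(** The value of the series at t = 1. *)
Definition ev (f : V) : H := \sum_(i \in [set: int]) f i.

Let evE N f : supported N f -> ev f = \sum_(i <- window N) f i.
Proof. exact: fsum_window. Qed.

Let ev_shift z f : ev (tshift z f) = ev f.
Proof. exact: (fsum_shift f (- z)). Qed.

Let ev_lin N (a : R[i]) f g : supported N f -> supported N g ->
  ev (fun i => a *: f i + g i) = a *: ev f + ev g.
Proof.
move=> fs gs; rewrite (evE fs) (evE gs) (@evE N).
  by rewrite scaler_sumr -big_split.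
by move=> i hi; rewrite fs // gs // scaler0 addr0.
Qed.

(** Sort the terms <f_i, g_j> of the inner product of the values at t = 1 by the
    difference k = j - i. *)
Lemma dot_ev N f g : supported N f -> supported N g ->
  dotH (ev f) (ev g) = \sum_(k <- window (N + N)) fdot (tshift k f) g.
Proof.
move=> fs gs; rewrite (evE fs).
transitivity (\sum_(i <- window N) \sum_(k <- window (N + N))
    dotH (f i) (g (i + k))).
  have -> : dotH (\sum_(i <- window N) f i) (ev g) =
      \sum_(i <- window N) dotH (f i) (ev g).
    elim/big_rec2: _ => [|i x y _ <-]; [exact: dot0l|exact: dotDl].
  rewrite big_seq [RHS]big_seq; apply: eq_bigr => i.
  rewrite mem_window => hi.
  rewrite -(@fsum_window _ _ (fun k => dotH (f i) (g (i + k)))); last first.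
    by move=> k hk; rewrite gs ?dot0r //; lia.
  under eq_fsbigr do rewrite addrC.
  rewrite (fsum_shift (fun j => dotH (f i) (g j))) (evE gs).
  rewrite (@fsum_window _ N); last by move=> j hj; rewrite gs ?dot0r.
  elim/big_rec2: _ => [|j x y _ <-]; [exact: dot0r|exact: dotDr].
rewrite exchange_big; apply: eq_bigr => k _.
rewrite fdot_shift (fdotEl _ fs); apply: eq_bigr => i _.
by rewrite /tshift opprK.
Qed.

Lemma dot_ev_wandering w w' : wandering w -> wandering w' ->
  dotH (ev w) (ev w') = fdot w w'.
Proof.
move=> Ww Ww'; have [_ ws _] := Ww; have [_ ws' _] := Ww'.
rewrite (dot_ev ws ws') (bigD1_seq 0) ?fset_uniq ?mem_window //=.
rewrite tshift0 big1 ?addr0 // => k k0.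
exact: wandering_shift.
Qed.

Lemma wandering_lin (a : R[i]) w w' : wandering w -> wandering w' ->
  wandering (fun i => a *: w i + w' i).
Proof.
move=> [Mw ws hw] [Mw' ws' hw']; split; first exact: Mlin.
  by move=> i hi; rewrite ws // ws' // scaler0 addr0.
by move=> m Mm; rewrite (fdot_linr _ _ ws ws') hw // hw' // mulr0 addr0.
Qed.

Lemma ev_wandering_inj w w' : wandering w -> wandering w' ->
  ev w = ev w' -> w = w'.
Proof.
move=> Ww Ww' e; have [_ ws _] := Ww; have [_ ws' _] := Ww'.
have Wu := wandering_lin (-1) Ww' Ww.
have [_ us _] := Wu.
have : fdot (fun i => -1 *: w' i + w i) (fun i => -1 *: w' i + w i) = 0.
  by rewrite -dot_ev_wandering // (ev_lin _ ws' ws) e scaleN1r addNr dot0l.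
move/(fdot_eq0 us) => u0; apply/funext => i.
have := congr1 (fun f => f i) u0; rewrite /= scaleN1r addrC => /eqP.
by rewrite subr_eq0 => /eqP.
Qed.

(** The vectors t^n h lie in the span of the translates t^k w, k >= 0, of
    wandering vectors, stated as an induction principle.  If a finitely
    supported m in M is orthogonal to t^(j+1) M, then splitting m = w + t m'
    leaves an m' in M that is orthogonal to t^j M.  After finitely many steps
    the remainder lies in M and is orthogonal to M, so it vanishes. *)
Lemma wandering_span (P : set V) :
  P (fun=> 0) -> (forall f g, P f -> P g -> P (fun i => f i + g i)) ->
  (forall f, P f -> P (tshift 1 f)) -> (forall w, wandering w -> P w) ->
  forall (h : H), P (tshift n%:Z (delta h)).
Proof.
move=> P0 PD PS PW.
suff span j : forall m N, supported N m -> M m ->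
    (forall m', M m' -> fdot (tshift j%:Z m') m = 0) -> P m.
  move=> h; have ds : supported n (tshift n%:Z (delta h)).
    by move=> i hi; rewrite /tshift /delta; case: eqP => //; lia.
  (* t^(2n+1) M lives in degrees above n *)
  apply: (span n.*2.+1 _ _ ds).
    by apply: Mhigh => i hi; rewrite /tshift /delta; case: eqP => //; lia.
  move=> m' Mm'; rewrite (fdotEr _ ds) big1 // => i _.
  rewrite {2}/tshift /delta; case: eqP => [h0|_]; last by rewrite dot0r.
  rewrite {1}/tshift (Mlow Mm') ?dot0l //; lia.
elim: j => [|j IH] m N ms Mm hm.
  by rewrite (fdot_eq0 ms) // -{1}(tshift0 m) hm.
have [w [m' [Ww Mm' mE]]] := wandering_decomposition Mm.
have [Mw ws hw] := Ww.
have m's : supported (N + n).+1 m'.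
  move=> i hi; have := congr1 (fun f => f (i + 1)) mE.
  by rewrite /tshift addrK /= ms ?ws ?add0r //; lia.
rewrite mE; apply: PD; [exact: PW|apply: PS].
apply: (IH m' _ m's Mm') => m'' Mm''.
have m'E : m' = tshift (-1) (fun i => -1 *: w i + m i).
  apply/funext => i; rewrite /tshift opprK {1}mE /tshift addrK.
  by rewrite scaleN1r addKr.
have s1 : supported (N + n) w by apply: supportedW ws; exact: leq_addl.
have s2 : supported (N + n) m by apply: supportedW ms; exact: leq_addr.
rewrite m'E -fdot_shift tshiftD -intS (fdot_linr _ _ s1 s2) hm //.
by rewrite intS -tshiftD hw ?mulr0 ?addr0 //; exact: Mshift.
Qed.

(** A finite sum of translates t^k w_k of wandering vectors has the same value
    at t = 1 as the wandering vector sum_k w_k, and t^n h has value h. *)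
Lemma wandering_exists h : exists2 w, wandering w & ev w = h.
Proof.
pose P := [set f : V | exists N, supported N f /\
  exists2 w, wandering w & ev w = ev f].
suff [N [_ [w Ww we]]] : P (tshift n%:Z (delta h)).
  exists w; rewrite // we ev_shift (@evE 0); last first.
    by move=> i; rewrite /delta; case: eqP => // ->.
  by rewrite window0 big_seq_fset1.
apply: (@wandering_span P).
- exists 0%N; split=> //; exists (fun=> 0) => //.
  split=> // m _; rewrite (@fdotEr _ _ 0) // big1 // => i _; exact: dot0r.
- move=> f g [N [fs [w Ww we]]] [N' [gs [w' Ww' we']]].
  have fs' : supported (N + N') f by apply: supportedW fs; exact: leq_addr.
  have gs' : supported (N + N') g by apply: supportedW gs; exact: leq_addl.
  have E : (fun i => f i + g i) = fun i => 1 *: f i + g i.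
    by apply/funext => i; rewrite scale1r.
  exists (N + N')%N; split; first by move=> i hi; rewrite fs' // gs' // addr0.
  exists (fun i => 1 *: w i + w' i); first exact: wandering_lin.
  have [_ ws _] := Ww; have [_ ws' _] := Ww'.
  by rewrite E (ev_lin _ fs' gs') (ev_lin _ ws ws') we we'.
- move=> f [N [fs [w Ww we]]]; exists N.+1; split.
    by move=> i hi; rewrite /tshift fs //; lia.
  by exists w; rewrite // ev_shift.
- by move=> w Ww; exists n; split; [case: Ww|exists w].
Qed.

Lemma commutant_adj b : commutant (vna_set A) b -> commutant (vna_set A) (adj b).
Proof.
move=> hb a /vna_adj Aa; rewrite -[a in LHS]adjK -adjM.
by rewrite -(hb _ Aa) adjM adjK.
Qed.

Lemma wandering_bop b w : commutant (vna_set A) b -> wandering w ->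
  wandering (fun i => b (w i)).
Proof.
move=> hb [Mw ws hw]; split; first exact: Mcomm.
  by move=> i hi; rewrite ws // linear0.
move=> m Mm; rewrite -[b]adjK -fdot_bop; apply: (hw (fun i => adj b (m i))).
by apply: Mcomm Mm; exact: commutant_adj.
Qed.

(** The columns of theta are the wandering vectors of M, normalised by their
    value at t = 1.  The two clauses are the inclusions theta H[t] <= M and
    theta^* M <= H[[t]]; together they say M = theta H[[t]]. *)
Theorem beurling_lax : exists theta : ppu A,
  (forall h, M (lapply theta h)) /\
  (forall f, M f -> forall k, k < 0 -> act (star theta) f k = 0).
Proof.
have /choice[w wP] : forall h, exists w, wandering w /\ ev w = h.
  by move=> h; have [w] := wandering_exists h; exists w.
have wW h : wandering (w h) by case: (wP h).
have evw h : ev (w h) = h by case: (wP h).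
have ws h : supported n (w h) by case: (wW h).
have wlin i : linear (fun h => w h i).
  move=> a x y; suff -> : w (a *: x + y) = fun i => a *: w x i + w y i by [].
  apply: ev_wandering_inj => //; first exact: wandering_lin.
  by rewrite (ev_lin _ (ws x) (ws y)) !evw.
have wle i h : `|w h i| <= `|h|.
  rewrite -(ler_pXn2r (_ : 0 < 2)%N) ?nnegrE // -!dot_normE.
  by rewrite -[in leRHS](evw h) dot_ev_wandering //; exact: fdot_ge (ws h).
have /choice[a aE] : forall i, exists b : bop H, bop_fun b = fun h => w h i.
  by move=> i; apply: bop_of_contraction.
have as_ : supported n a.
  by move=> i hi; apply/bopP => h; rewrite aE ws.
have afin : finite_set [set i | a i <> 0].
  apply: sub_finite_set (finite_fset (window n)) => i /= ai.
  by rewrite mem_window leqNgt; apply/negP => /as_.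
pose theta : laurent (bop H) := Laurent afin.
have thetaE h : lapply theta h = w h by apply/funext => i; rewrite /lapply /= aE.
have thetaA i : vna_set A (theta i).
  apply/vnaP => b hb; apply/bopP => h; rewrite !bopME /= !aE.
  suff -> : w (b h) = fun i => b (w h i) by [].
  apply: ev_wandering_inj => //; first exact: wandering_bop.
  rewrite evw (@evE n); last by move=> j hj; rewrite ws // linear0.
  by rewrite -linear_sum -(evE (ws h)) evw.
have theta_starl : star theta * theta = 1.
  apply/laurentP => k; apply/bopP => h; apply: dot_injr => v.
  rewrite dotC [RHS]dotC; congr (_ ^*)%R.
  have -> : (star theta * theta) k h = act (star theta) (w h) k.
    by rewrite -thetaE act_lapply.
  rewrite dot_act_star thetaE lcoef1.
  have [->|k0] := eqVneq k 0.
    by rewrite oppr0 tshift0 -dot_ev_wandering // !evw.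
  by rewrite wandering_shift ?oppr_eq0 // bop0E dot0l.
have theta_starr : theta * star theta = 1.
  apply/laurentP => k; apply/bopP => h.
  pose P := [set f : V | act (theta * star theta) f = f].
  have : P (tshift n%:Z (delta h)).
    apply: (@wandering_span P); rewrite /P /=.
    - exact: act0.
    - move=> f g hf hg; rewrite (_ : (fun i => f i + g i) = fun i => 1 *: f i + g i).
        by rewrite act_lin hf hg.
      by apply/funext => i; rewrite scale1r.
    - by move=> f hf; rewrite act_shift hf.
    - move=> u Wu; have -> : u = w (ev u) by apply: ev_wandering_inj.
      by rewrite -thetaE act_lapply -mulrA theta_starl mulr1.
  rewrite /P /= act_shift_delta => /(congr1 (fun f => f (k + n%:Z))).
  rewrite /tshift addrK /lapply => ->.
  by rewrite /delta; case: eqP.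
have theta_sum : sum_coef theta = 1.
  apply/bopP => h; rewrite /sum_coef (@fsum_window _ n) // bop_sumE.
  rewrite bop1E -[RHS]evw (evE (ws h)); apply: eq_bigr => i _.
  by rewrite /= aE.
exists (PPU thetaA theta_starl theta_starr theta_sum); split=> /= [h|f Mf k k0].
  by rewrite thetaE; case: (wW h).
apply: dot_injr => v; rewrite dot0r dotC dot_act_star thetaE.
have [_ _ hw] := wW v.
have -> : tshift (- k) f = tshift 1 (tshift (`|- k - 1|%N)%:Z f).
  by rewrite tshiftD; congr (tshift _ f); lia.
by rewrite hw ?rmorph0 //; exact: Mshift.
Qed.

End BeurlingLax.

(** * The order on the paraunitary group *)

Section Order.
Variables (R : realType) (H : hilbertType R) (A : von_neumann_algebra H).
Local Notation L := (laurent (bop H)).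
Local Notation V := (int -> H).
Implicit Types (p q r : ppu A) (f : V).

(** p^-1 H[[t]], when p is invertible. *)
Definition plus_space (p : L) : set V :=
  [set f | forall k, k < 0 -> act p f k = 0].

Lemma plus_space_low n (p : L) f i : supported n p -> star p * p = 1 ->
  plus_space p f -> i < - n%:Z -> f i = 0.
Proof.
move=> pn pp pf hi; rewrite -[f]act1 -pp act_mul.
have sn : supported n (star p) by move=> j hj; rewrite starE pn ?adj0 // abszN.
rewrite (actE _ _ sn) big_seq big1 // => j; rewrite mem_window => hj.
by rewrite pf ?linear0 //; lia.
Qed.

Lemma plus_space_high n (p : L) f : supported n p ->
  (forall i, i < n%:Z -> f i = 0) -> plus_space p f.
Proof.
move=> pn hf k k0; rewrite (actE _ _ pn) big_seq big1 // => j.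
by rewrite mem_window => hj; rewrite hf ?linear0 //; lia.
Qed.

Lemma plus_space_lin (p : L) (a : R[i]) f g : plus_space p f -> plus_space p g ->
  plus_space p (fun i => a *: f i + g i).
Proof.
by move=> pf pg k k0; rewrite act_lin pf // pg // scaler0 addr0.
Qed.

Lemma plus_space_shift (p : L) f : plus_space p f -> plus_space p (tshift 1 f).
Proof. by move=> pf k k0; rewrite act_shift /tshift pf //; lia. Qed.

Lemma plus_space_closed (p : L) (u : nat -> V) f :
  (forall k, plus_space p (u k)) -> (forall i, (fun k => u k i) @ \oo --> f i) ->
  plus_space p f.
Proof.
move=> pu uf k k0; have [n pn] := laurent_supported p.
have hausH : hausdorff_space H := @norm_hausdorff _ H.
have c : (fun m => act p (u m) k) @ \oo --> act p f k.
  under eq_fun do rewrite (actE _ _ pn); rewrite (actE _ _ pn).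
  apply: (cvg_big (U := H) add_continuous) => i _.
  exact: (continuous_cvg _ (@bop_continuous _ _ (p i) _) (uf _)).
apply: (cvg_unique hausH c).
rewrite (_ : (fun m => _) = fun=> 0); first exact: cvg_cst.
by apply/funext => m; exact: pu.
Qed.

Lemma plus_space_bop p (b : bop H) f : commutant (vna_set A) b ->
  plus_space p f -> plus_space p (fun i => b (f i)).
Proof.
move=> hb pf k k0; rewrite act_bop ?pf ?linear0 // => i.
by rewrite hb //; exact: ppu_coef.
Qed.

Lemma ppu_leE p q : ppu_le p q <->
  forall i, i < 0 -> (ppu_val q * star (ppu_val p)) i = 0.
Proof. by []. Qed.

(** The right-hand side is the inclusion p^-1 H[t] <= q^-1 H[[t]]. *)
Lemma ppu_le_plus_space p q : ppu_le p q <->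
  forall h, plus_space q (lapply (star (ppu_val p)) h).
Proof.
rewrite ppu_leE; split=> [pq h k k0|pq k k0].
  by rewrite act_lapply /lapply pq.
by apply/bopP => h; have := pq h k k0; rewrite act_lapply.
Qed.

Lemma ppu_meet_exists p q : exists m, is_meet (@ppu_le R H A) p q m.
Proof.
have [a pa] := laurent_supported p; have [b qb] := laurent_supported q.
pose n := (a + b)%N.
have pn : supported n p by apply: supportedW pa; exact: leq_addr.
have qn : supported n q by apply: supportedW qb; exact: leq_addl.
have [||||||th [thM Mth]] := @beurling_lax R H A n (plus_space p `&` plus_space q).
- by move=> c f g [pf qf] [pg qg]; split; exact: plus_space_lin.
- by move=> f [pf qf]; split; exact: plus_space_shift.
- by move=> f i [pf _]; exact: plus_space_low pn (ppu_starl p) pf.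
- by move=> f hf; split; [exact: plus_space_high pn hf|exact: plus_space_high qn hf].
- by move=> u f hu uf; split; apply: plus_space_closed uf => k; case: (hu k).
- by move=> c f hc [pf qf]; split; exact: plus_space_bop.
exists (th^-1)%g; split.
- by apply/ppu_le_plus_space => h; rewrite /= starK; case: (thM h).
- by apply/ppu_le_plus_space => h; rewrite /= starK; case: (thM h).
- move=> r /ppu_le_plus_space rp /ppu_le_plus_space rq; apply/ppu_le_plus_space => h.
  by apply: Mth; split.
Qed.

Lemma laurent_rev_finite (p : L) : finite_set [set i | p (- i) <> 0].
Proof.
have [n pn] := laurent_supported p.
apply: sub_finite_set (finite_fset (window n)) => i /= pi.
by rewrite mem_window leqNgt -abszN; apply/negP => /pn.
Qed.

(** The substitution t |-> t^-1. *)
Definition laurent_rev (p : L) : L := Laurent (laurent_rev_finite p).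

Lemma laurent_revM (p q : L) : laurent_rev (p * q) = laurent_rev p * laurent_rev q.
Proof.
apply/laurentP => k; rewrite lcoefM -[LHS]/((p * q) (- k)) lcoefM.
rewrite (reindex_fsbigT -%R); last by exists -%R; exact: opprK.
by apply: eq_fsbigr => i _; rewrite /= opprB opprK addrC.
Qed.

Lemma laurent_rev_star (p : L) : laurent_rev (star p) = star (laurent_rev p).
Proof. by apply/laurentP. Qed.

Lemma laurent_rev1 : laurent_rev 1 = 1.
Proof. by apply/laurentP => k; rewrite /= oppr_eq0. Qed.

Lemma sum_coef_rev (p : L) : sum_coef (laurent_rev p) = sum_coef p.
Proof.
by rewrite /sum_coef [RHS](reindex_fsbigT -%R) //; exists -%R; exact: opprK.
Qed.

Program Definition ppu_rev p : ppu A := @PPU _ _ A (laurent_rev p) _ _ _ _.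
Next Obligation. by move=> p i; exact: ppu_coef. Qed.
Next Obligation.
by move=> p; rewrite -laurent_rev_star -laurent_revM ppu_starl laurent_rev1.
Qed.
Next Obligation.
by move=> p; rewrite -laurent_rev_star -laurent_revM ppu_starr laurent_rev1.
Qed.
Next Obligation. by move=> p; rewrite sum_coef_rev ppu_sum. Qed.

Lemma ppu_revK : involutive ppu_rev.
Proof.
by move=> p; apply/ppuP/laurentP => i /=; rewrite opprK.
Qed.

(** Substituting t^-1 in p q^* gives the reversal of (q p^* )^*, whose degrees
    are those of q p^*. *)
Lemma ppu_le_rev p q : ppu_le p q -> ppu_le (ppu_rev q) (ppu_rev p).
Proof.
rewrite !ppu_leE => pq i i0.
rewrite -[LHS]/((laurent_rev p * star (laurent_rev q)) i).
rewrite -laurent_rev_star -laurent_revM.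
rewrite -[LHS]/((ppu_val p * star (ppu_val q)) (- i)).
by rewrite -[X in X * _]starK -starM starE opprK pq // adj0.
Qed.

Lemma ppu_join_exists p q : exists j, is_join (@ppu_le R H A) p q j.
Proof.
have [m [mp mq mm]] := ppu_meet_exists (ppu_rev p) (ppu_rev q).
exists (ppu_rev m); split.
- by rewrite -[p]ppu_revK; exact: ppu_le_rev.
- by rewrite -[q]ppu_revK; exact: ppu_le_rev.
- move=> r pr qr; rewrite -[r]ppu_revK.
  by apply/ppu_le_rev/mm; exact: ppu_le_rev.
Qed.

Lemma ppu_le_refl p : ppu_le p p.
Proof. by move=> i i0; rewrite mulgV lcoef1 lt_eqF. Qed.

(** The quotient x = q p^-1 and its inverse x^* are polynomials in t, so x is
    concentrated in degree 0 and equals its value 1 at t = 1. *)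
Lemma ppu_le_anti p q : ppu_le p q -> ppu_le q p -> p = q.
Proof.
rewrite !ppu_leE => pq qp; set x := ppu_val q * star (ppu_val p) in pq.
have x0 i : i != 0 -> x i = 0.
  rewrite neq_lt => /orP[|i0]; first exact: pq.
  rewrite -[x]starK starE /x starM starK qp ?adj0 // oppr_lt0 //.
have xsum : sum_coef x = 1 by rewrite sum_coefM sum_coef_star !ppu_sum Defs.adj1 mulr1.
have x1 : x = 1.
  apply/laurentP => i; rewrite lcoef1; have [->|/x0//] := eqVneq i 0.
  rewrite -xsum /sum_coef (@fsum_window _ 0); last by move=> j hj; apply: x0; lia.
  by rewrite window0 big_seq_fset1.
apply/ppuP; rewrite -[RHS]mulr1 -(ppu_starl p) mulrA -/x x1 mul1r //.
Qed.

Lemma ppu_le_trans p q r : ppu_le p q -> ppu_le q r -> ppu_le p r.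
Proof.
rewrite !ppu_leE => pq qr k k0.
rewrite -[X in X * _]mulr1 -(ppu_starl q) mulrA -mulrA lcoefM.
rewrite fsbig1 // => i _; have [/qr ->|i0] := ltP i 0; first by rewrite mul0r.
by rewrite pq ?mulr0 //; lia.
Qed.

End Order.

Theorem theorem3 (R : realType) (H : hilbertType R)
    (A : von_neumann_algebra H) :
  is_lattice_order (@ppu_le R H A).
Proof.
split; last by move=> p q; split; [exact: ppu_meet_exists|exact: ppu_join_exists].
split; [exact: ppu_le_refl|exact: ppu_le_anti|exact: ppu_le_trans].
Qed.
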